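(* Any decomposable $2$-step nilpotent real Lie algebra of dimension seven has a coclosed $\mathrm{G}_2$-structure.
   Context: A Lie algebra is decomposable if it is the direct sum of two (non-zero) ideals. A Lie algebra $\mathfrak{g}$ is $2$-step nilpotent if it is non-abelian and $[\mathfrak{g},[\mathfrak{g},\mathfrak{g}]]=0$. $d$ denotes the Chevalley–Eilenberg differential and $e^{ijk}=e^i\wedge e^j\wedge e^k$, etc. A $\mathrm{G}_2$-structure on a $7$-dimensional real Lie algebra $\mathfrak{g}$ is a positive $3$-form $\varphi\in\Lambda^3(\mathfrak{g}^* )$, i.e. one for which there is a coframe $\{e^1,\dots,e^7\}$ of $\mathfrak{g}^*$ with $\varphi=e^{127}+e^{347}+e^{567}+e^{135}-e^{146}-e^{236}-e^{245}$. It determines the inner product making $\{e^i\}$ orthonormal and the orientation $e^{1\cdots7}$, and its Hodge dual is $\phi=\star_\varphi\varphi=e^{1234}+e^{1256}+e^{1367}+e^{1457}+e^{2357}-e^{2467}+e^{3456}$. It is coclosed if $d\phi=0$. *)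

(* Defs.v *)
From HB Require Import structures.
From mathcomp Require Import all_boot all_order all_fingroup all_algebra.
From mathcomp Require Import reals ring.

Set Implicit Arguments.
Unset Strict Implicit.
Unset Printing Implicit Defensive.

Import Order.TTheory GRing.Theory Num.Theory.

Local Open Scope ring_scope.

Section LieAlgebras.
Variables (R : fieldType) (g : vectType R).
Implicit Types (br : g -> g -> g) (U W : {vspace g}).

Record is_lie_bracket br : Prop := IsLieBracket {
  lie_linear_r : forall x, linear (br x);
  lie_linear_l : forall y, linear (br^~ y);
  lie_alternating : forall x, br x x = 0;
  lie_jacobi : forall x y z,
    br x (br y z) + br y (br z x) + br z (br x y) = 0 }.

(* For an alternating bracket, left and right ideals coincide. *)
Definition is_ideal br U : Prop :=
  forall x u, u \in U -> br x u \in U.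

Definition decomposable br : Prop :=
  exists U W : {vspace g},
    [/\ is_ideal br U, is_ideal br W, U != 0%VS, W != 0%VS
      & (U + W)%VS = fullv /\ (U :&: W)%VS = 0%VS].

Definition two_step_nilpotent br : Prop :=
  (exists x y, br x y != 0) /\ (forall x y z, br x (br y z) = 0).

End LieAlgebras.

(* The ambient type of k-forms: all scalar functions of k vectors. The
   elements of Lambda^k(g^* ) are those that are multilinear and alternating,
   which is automatic for the combinations of wedge products used below. *)
Definition kform (R : fieldType) (g : vectType R) (k : nat) : Type :=
  ('I_k -> g) -> R.

Section Forms.
Variables (R : fieldType) (g : vectType R).

Definition fcons (A : Type) k (a : A) (x : 'I_k -> A) : 'I_k.+1 -> A :=
  fun i => oapp x a (unlift ord0 i).

Definition fcat (A : Type) k l (x : 'I_k -> A) (y : 'I_l -> A) :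
    'I_(k + l) -> A :=
  fun i => match split i with inl a => x a | inr c => y c end.

(* d alpha (x_0, ..., x_(k+1))
     = \sum_(i < j') (-1)^(i + j')
         alpha ([x_i, x_j'], x_0, .., ^x_i, .., ^x_j', .., x_(k+1)).
   The pair i < j' is encoded by (i, j) with i <= j and j' = lift i j = j + 1;
   l |-> lift i (lift j l) enumerates increasingly the indices other than
   i and j'. *)
Definition CE_d (br : g -> g -> g) k (alpha : kform g k.+1) : kform g k.+2 :=
  fun x => \sum_(i < k.+2) \sum_(j < k.+1 | (i <= j)%N)
    (-1) ^+ (i + j.+1) *
    alpha (fcons (br (x i) (x (lift i j)))
                 (fun l => x (lift i (lift j l)))).

(* (a_0 /\ ... /\ a_(k-1)) (x_0, ..., x_(k-1)) = \det (a_i (x_j)). *)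
Definition wedge k (a : 'I_k -> g -> R) : kform g k :=
  fun x => \det (\matrix_(i < k, j < k) a i (x j)).

(* The coframe dual to the frame b is e^i = coord b (i - 1), and every coframe
   is dual to exactly one frame. For s = (s_1, ..., s_k), with 1-based indices,
   coframe_form b s is e^(s_1) /\ ... /\ e^(s_k). *)
Definition coframe_form n (b : n.+1.-tuple g) k (s : k.-tuple nat) :
    kform g k :=
  wedge (fun i => coord b (inord (tnth s i).-1)).

Definition volume_form n (b : n.-tuple g) : kform g n :=
  wedge (fun i => coord b i).

(* Hodge star of the inner product that makes the frame b orthonormal and of
   the orientation e^1 /\ ... /\ e^n. It is the contraction of vol with the
   metric dual of alpha,
     ( *alpha)(w) = 1/k! \sum_I alpha(b_I) vol(b_I, w),
   the unique ( *alpha) such that beta /\ *alpha = <beta, alpha> vol for all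
   k-forms beta; on the orthonormal basis of k-forms this gives
   *e^I = sgn(I, I^c) e^(I^c). *)
Definition hodge k l (b : (k + l).-tuple g) (alpha : kform g k) : kform g l :=
  fun w => (k`!%:R)^-1 *
    \sum_(I : {ffun 'I_k -> 'I_(k + l)})
      alpha (fun i => tnth b (I i)) *
      volume_form b (fcat (fun i => tnth b (I i)) w).

End Forms.

Section HodgeDual.
Variables (R : numFieldType) (g : vectType R).

Lemma det_col_delta n (M : 'M[R]_n.+1) (p : 'I_n.+1) :
  (forall i, M i ord0 = (i == p)%:R) ->
  \det M = (-1) ^+ p * \det (row' p (col' ord0 M)).
Proof.
move=> Mp; rewrite (expand_det_col _ ord0) (bigD1 p) //= big1 => [|i /negPf ip].
  by rewrite Mp eqxx mul1r addr0 /cofactor addn0.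
by rewrite Mp ip mul0r.
Qed.

Lemma volume_form_perm k l (b : (k + l).-tuple g) (s : 'S_k)
    (x : 'I_k -> g) (w : 'I_l -> g) :
  volume_form b (fcat (fun i => x (s i)) w) =
  (-1) ^+ s * volume_form b (fcat x w).
Proof.
rewrite /volume_form /wedge.
set M := \matrix_(i, j) coord b i (fcat x w j).
have -> : \matrix_(i, j) coord b i (fcat (fun i => x (s i)) w j) =
    M *m block_mx (perm_mx s^-1) 0 0 1%:M.
  rewrite -[M in RHS]hsubmxK mul_row_block !mulmx0 mulmx1 addr0 add0r -col_permE.
  apply/matrixP => i j; rewrite !mxE /fcat; case: splitP => c jc; rewrite !mxE.
    by rewrite /fcat (unsplitK (inl _ (s c))).
  by rewrite /fcat (unsplitK (inr _ c)).
by rewrite det_mulmx det_ublock det1 mulr1 det_perm odd_permV mulrC.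
Qed.

Lemma hodge_wedge k l (b : (k + l).-tuple g) (s : 'I_k -> 'I_(k + l)) w :
  free b ->
  hodge b (wedge (fun i => coord b (s i))) w =
  volume_form b (fcat (fun i => tnth b (s i)) w).
Proof.
move=> fb; rewrite /hodge /wedge.
under eq_bigr => I _ do rewrite /determinant mulr_suml.
rewrite exchange_big /=.
under eq_bigr => t _.
  rewrite (bigD1 [ffun i => s ((t^-1)%g i)]) //= [X in _ + X]big1 => [|I It]; last first.
    have [i ti] : exists i, I (t i) != s i.
      apply/existsP; apply: contraNT It; rewrite negb_exists => /forallP H.
      apply/eqP/ffunP => i; rewrite ffunE; have := H ((t^-1)%g i).
      by rewrite permKV negbK => /eqP.
    rewrite (bigD1 i) //= mxE (tnth_nth 0) coord_free // (negPf ti).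
    by rewrite mul0r mulr0 mul0r.
  rewrite addr0 big1 => [|i _]; last first.
    by rewrite mxE (tnth_nth 0) coord_free // ffunE permK eqxx.
  have -> : volume_form b (fcat (fun i => tnth b ([ffun i => s ((t^-1)%g i)] i)) w)
     = (-1) ^+ t * volume_form b (fcat (fun i => tnth b (s i)) w).
    rewrite -odd_permV -volume_form_perm /volume_form /wedge; congr (\det _).
    apply/matrixP => i j; rewrite !mxE /fcat; congr coord.
    by case: split => // c; rewrite ffunE.
  rewrite mulr1 mulrA -signr_addb addbb mul1r; over.
by rewrite sumr_const card_Sn -[X in _ * X]mulr_natl mulKf // pnatr_eq0 -lt0n fact_gt0.
Qed.

End HodgeDual.

Section G2.
Variables (R : realType) (g : vectType R).

Definition G2_form (b : 7.-tuple g) : kform g 3 := fun x =>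
  coframe_form b [tuple 1; 2; 7]%N x + coframe_form b [tuple 3; 4; 7]%N x
  + coframe_form b [tuple 5; 6; 7]%N x + coframe_form b [tuple 1; 3; 5]%N x
  - coframe_form b [tuple 1; 4; 6]%N x - coframe_form b [tuple 2; 3; 6]%N x
  - coframe_form b [tuple 2; 4; 5]%N x.

Definition G2_adapted (phi : kform g 3) (b : 7.-tuple g) : Prop :=
  basis_of fullv b /\ phi =1 G2_form b.

Definition is_G2_structure (phi : kform g 3) : Prop :=
  exists b, G2_adapted phi b.

(* The metric and the orientation, hence the Hodge star, are the same for all
   adapted frames of phi, so any one of them may be used to compute it. *)
Definition coclosed (br : g -> g -> g) (phi : kform g 3) : Prop :=
  exists b : 7.-tuple g, G2_adapted phi b /\
    forall x, CE_d br (hodge (k := 3) (l := 4) b phi) x = 0.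

Definition dual_G2_form (b : 7.-tuple g) : kform g 4 := fun x =>
  coframe_form b [tuple 1; 2; 3; 4]%N x + coframe_form b [tuple 1; 2; 5; 6]%N x
  + coframe_form b [tuple 1; 3; 6; 7]%N x + coframe_form b [tuple 1; 4; 5; 7]%N x
  + coframe_form b [tuple 2; 3; 5; 7]%N x - coframe_form b [tuple 2; 4; 6; 7]%N x
  + coframe_form b [tuple 3; 4; 5; 6]%N x.

(* p, q, r are the positions at which s_1, s_2, s_3 are successively removed
   from 1, ..., 7, and t lists the indices that remain. *)
Lemma hodge_coframe_form (b : 7.-tuple g) (s : 3.-tuple nat) (t : 4.-tuple nat)
    (p : 'I_7) (q : 'I_6) (r : 'I_5) w : free b ->
  val s = [:: p.+1; (bump p q).+1; (bump p (bump q r)).+1] ->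
  val t = [seq (bump p (bump q (bump r i))).+1 | i <- iota 0 4] ->
  hodge (k := 3) (l := 4) b (coframe_form b s) w =
  (-1) ^+ (p + q + r) * coframe_form b t w.
Proof.
move=> fb sE tE; pose f (i : 'I_3) : 'I_7 := inord (tnth s i).-1.
have -> : hodge (k := 3) (l := 4) b (coframe_form b s) w =
    volume_form b (@fcat g 3 4 (fun i => tnth b (f i)) w).
  exact: (@hodge_wedge R g 3 4 b f w fb).
rewrite /volume_form /coframe_form /wedge; set M := (X in \det X).
have ME i (j : 'I_7) (c : 'I_3) : j = c :> nat -> M i j = (i == f c)%:R.
  move=> jc; rewrite mxE (_ : j = @lshift 3 4 c); last exact: val_inj.
  by rewrite /fcat (unsplitK (inl _ c)) (tnth_nth 0) coord_free // eq_sym.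
have MR i (j : 'I_4) : M i (@rshift 3 4 j) = coord b i (w j).
  by rewrite mxE /fcat (unsplitK (inr _ j)).
clearbody M.
have f0 : f ord0 = p.
  by apply: val_inj; rewrite /f (tnth_nth 0%N) /= sE /= inordK.
have f1 : f (lift ord0 ord0) = lift p q.
  by apply: val_inj; rewrite /f (tnth_nth 0%N) /= sE /= (inordK (ltn_ord (lift p q))).
have f2 : f (lift ord0 (lift ord0 ord0)) = lift p (lift q r).
  apply: val_inj; rewrite /f (tnth_nth 0%N) /= sE /=.
  by rewrite (inordK (ltn_ord (lift p (lift q r)))).
rewrite (det_col_delta (p := p)) => [|i]; last by rewrite (ME _ _ ord0) ?f0.
rewrite (det_col_delta (p := q)) => [|i]; last first.
  by rewrite !mxE (ME _ _ (lift ord0 ord0)) // f1 (inj_eq lift_inj).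
rewrite (det_col_delta (p := r)) => [|i]; last first.
  by rewrite !mxE (ME _ _ (lift ord0 (lift ord0 ord0))) // f2 !(inj_eq lift_inj).
rewrite !mulrA -!exprD; congr (_ * \det _); apply/matrixP => i j.
rewrite !mxE.
have -> : @lift 7 ord0 (@lift 6 ord0 (@lift 5 ord0 j)) = @rshift 3 4 j.
  exact: val_inj.
rewrite MR; congr (coord _ _ _).
apply: val_inj; rewrite (tnth_nth 0%N) /= tE (nth_map 0%N) ?size_iota // nth_iota //.
by rewrite add0n -pred_Sn (inordK (ltn_ord (lift p (lift q (lift r i))))).
Qed.

Lemma hodge_G2_form (b : 7.-tuple g) : basis_of fullv b ->
  hodge (k := 3) (l := 4) b (G2_form b) =1 dual_G2_form b.
Proof.
move=> /basis_free fb w.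
have H s t p q r (hp : (p < 7)%N) (hq : (q < 6)%N) (hr : (r < 5)%N) :=
  @hodge_coframe_form b s t (Ordinal hp) (Ordinal hq) (Ordinal hr) w fb.
have -> : hodge (k := 3) (l := 4) b (G2_form b) w =
  let h (s : 3.-tuple nat) := hodge (k := 3) (l := 4) b (coframe_form b s) w in
  h [tuple 1; 2; 7]%N + h [tuple 3; 4; 7]%N + h [tuple 5; 6; 7]%N
  + h [tuple 1; 3; 5]%N - h [tuple 1; 4; 6]%N - h [tuple 2; 3; 6]%N
  - h [tuple 2; 4; 5]%N.
  rewrite /hodge -!(mulrDr, mulrBr) -!(big_split, sumrB) /=.
  congr (_ * _); apply: eq_bigr => I _.
  by rewrite !(mulrDl, mulrBl, mulNr).
rewrite /= /dual_G2_form.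
rewrite (H [tuple 1; 2; 7]%N [tuple 3; 4; 5; 6]%N 0 0 4)%N //.
rewrite (H [tuple 3; 4; 7]%N [tuple 1; 2; 5; 6]%N 2 2 4)%N //.
rewrite (H [tuple 5; 6; 7]%N [tuple 1; 2; 3; 4]%N 4 4 4)%N //.
rewrite (H [tuple 1; 3; 5]%N [tuple 2; 4; 6; 7]%N 0 1 2)%N //.
rewrite (H [tuple 1; 4; 6]%N [tuple 2; 3; 5; 7]%N 0 2 3)%N //.
rewrite (H [tuple 2; 3; 6]%N [tuple 1; 4; 5; 7]%N 1 1 3)%N //.
rewrite (H [tuple 2; 4; 5]%N [tuple 1; 3; 6; 7]%N 1 2 2)%N //=.
by rewrite -!(signr_odd _ (_ + _)) /= !expr0 !expr1; ring.
Qed.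

End G2.

(* Main.v *)
(* A 2-step nilpotent g of dimension 7 with a 3-dimensional central subspace C
   containing [g, g] always carries a coclosed G2-structure. Let e^1, .., e^4
   vanish on C, and e^5, e^6, e^7 restrict to a coframe of C. Then
     *phi = e^1234 + e^56 /\ th_2 + e^67 /\ th_0 + e^75 /\ th_1
   with th_0, th_1, th_2 a self-dual triple in e^1, .., e^4, and *phi is closed
   as soon as the 3x3 matrix of the 4-forms de^(5+i) /\ th_j is symmetric. A
   change of basis of C multiplies this matrix on the left by an arbitrary
   invertible matrix, and if M = L D U with L, U invertible and D diagonal then
   (U^T L^-1) M = U^T D U is symmetric.
   If g = U + W is decomposable, U and W both meet the center Z, and the one of
   even dimension does so in dimension at least 2 because an alternating form
   on an odd-dimensional space is degenerate; so dim Z >= 3. If dim Z = 3 then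
   C = Z; otherwise g / Z has dimension at most 3, hence dim [g, g] <= 3 and C
   can be inserted between [g, g] and Z. *)

Require Import Defs.
From HB Require Import structures.
From mathcomp Require Import all_boot all_order all_algebra.
From mathcomp Require Import reals.
From mathcomp Require Import ring.

Set Implicit Arguments.
Unset Strict Implicit.
Unset Printing Implicit Defensive.

Import GRing.Theory Num.Theory.

Local Open Scope ring_scope.

(** * Explicit determinants of order three and four *)

Definition minor2 (R : pzRingType) (m : nat -> nat -> R) (i j k l : nat) : R :=
  m i k * m j l - m i l * m j k.

Lemma det3E (R : comNzRingType) (m : nat -> nat -> R) (d := minor2 m) :
  \det (\matrix_(i < 3, j < 3) m i j) =
    m 0%N 0%N * d 1 2 1 2 - m 0%N 1%N * d 1 2 0 2 + m 0%N 2%N * d 1 2 0 1.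
Proof.
rewrite /d.
set M := \matrix_(i, j) _.
have minorE (j : 'I_3) :
    \det (row' ord0 (col' j M)) = minor2 m 1 2 (bump j 0) (bump j 1).
  rewrite (expand_det_row _ ord0) !big_ord_recl !big_ord0 /cofactor.
  by rewrite !det_mx11 !mxE /minor2 /=; ring.
rewrite (expand_det_row _ ord0) !big_ord_recl !big_ord0 /cofactor !minorE.
by rewrite !mxE /bump /=; ring.
Qed.

(** Laplace expansion along the first two rows, each minor being paired with the complementary one
    of the last two rows. *)
Lemma det4E (R : comNzRingType) (m : nat -> nat -> R) (d := minor2 m) :
  \det (\matrix_(i < 4, j < 4) m i j) =
    d 0 1 0 1 * d 2 3 2 3 - d 0 1 0 2 * d 2 3 1 3 + d 0 1 0 3 * d 2 3 1 2
  + d 0 1 1 2 * d 2 3 0 3 - d 0 1 1 3 * d 2 3 0 2 + d 0 1 2 3 * d 2 3 0 1.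
Proof.
rewrite /d; set M := \matrix_(i, j) _.
have minorE (j : 'I_4) : \det (row' ord0 (col' j M)) =
  \det (\matrix_(i < 3, k < 3) m i.+1 (bump j k)).
  by congr (\det _); apply/matrixP => i k; rewrite !mxE.
rewrite (expand_det_row _ ord0) !big_ord_recl !big_ord0 /cofactor !minorE.
rewrite !(det3E (fun i k => m i.+1 (bump _ k))) !mxE /minor2 /bump /=.
ring.
Qed.

(** * Two-forms in four covectors and their wedge products *)

(* The coefficients of e^12, e^13, e^14, e^23, e^24, e^34; in all functions
   e : nat -> g -> R below, e k stands for e^(k+1). *)
Definition form2 (R : Type) : Type := (R * R * R * R * R * R)%type.

Definition two_form (R : pzRingType) (T : Type) (e : nat -> T -> R)
    (c : form2 R) (u v : T) : R :=
  let: (c01, c02, c03, c12, c13, c23) := c in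
  let w i j := e i u * e j v - e j u * e i v in
  c01 * w 0%N 1%N + c02 * w 0%N 2%N + c03 * w 0%N 3%N
  + c12 * w 1%N 2%N + c13 * w 1%N 3%N + c23 * w 2%N 3%N.

(** Signed sum over (2,2)-shuffles, the normalisation that agrees with wedges of covectors as
    determinants. *)
Definition wedge22 (R : pzRingType) (T : Type) (f h : T -> T -> R)
    (x y z t : T) : R :=
  f x y * h z t - f x z * h y t + f x t * h y z
  + f y z * h x t - f y t * h x z + f z t * h x y.

Definition wedge12 (R : pzRingType) (T : Type) (f : T -> R) (h : T -> T -> R)
    (x y z : T) : R :=
  f x * h y z - f y * h x z + f z * h x y.

(* The coefficient of 1234 in the wedge product of two 2-forms. *)
Definition pairing (R : pzRingType) (c d : form2 R) : R :=
  let: (c01, c02, c03, c12, c13, c23) := c in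
  let: (d01, d02, d03, d12, d13, d23) := d in
  c01 * d23 - c02 * d13 + c03 * d12 + c12 * d03 - c13 * d02 + c23 * d01.

(** Every 4-form in four covectors is a multiple of e^1234, written here as e^12 /\ e^34. Equalities
    of such 4-forms thus reduce to equalities of scalars. *)
Lemma wedge22_two_form (R : comNzRingType) (T : Type) (e : nat -> T -> R) c d
    x y z t :
  wedge22 (two_form e c) (two_form e d) x y z t =
  pairing c d * wedge22 (two_form e (1, 0, 0, 0, 0, 0))
                        (two_form e (0, 0, 0, 0, 0, 1)) x y z t.
Proof.
case: c => [[[[[c01 c02] c03] c12] c13] c23].
case: d => [[[[[d01 d02] d03] d12] d13] d23].
by rewrite /wedge22 /two_form /pairing; ring.
Qed.

(* 13 - 24, -(14 + 23) and 12 + 34. *)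
Definition theta (R : pzRingType) (k : nat) : form2 R :=
  match k with
  | 0 => (0, 1, 0, 0, -1, 0)
  | 1 => (0, 0, -1, -1, 0, 0)
  | _ => (1, 0, 0, 0, 0, 1)
  end.

(** * Closedness of the dual 4-form in a given frame *)

Section CoclosedFrame.
Variables (R : realType) (g : vectType R).

Lemma fcons0 (A : Type) k (u : A) (y : 'I_k -> A) : fcons u y ord0 = u.
Proof. by rewrite /fcons unlift_none. Qed.

Lemma fconsS (A : Type) k (u : A) (y : 'I_k -> A) (i : 'I_k) :
  fcons u y (lift ord0 i) = y i.
Proof. by rewrite /fcons liftK. Qed.

(** [CE_d] evaluates the form only with a bracket in the first slot, so its contraction with a
    vector killed by e^1, .., e^4 suffices; the term e^1234 drops out. *)
Lemma dual_G2_form_fcons (b : 7.-tuple g) (u : g) (y : 'I_3 -> g) :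
  let e (k : nat) : g -> R := coord b (inord k) in
  let th k := two_form e (theta R k) in
  let c f h := wedge12 f h (y (inord 0)) (y (inord 1)) (y (inord 2)) in
  (forall k, (k < 4)%N -> e k u = 0) ->
  dual_G2_form b (fcons u y) =
    e 4%N u * (c (e 5%N) (th 2%N) - c (e 6%N) (th 1%N))
  + e 5%N u * (c (e 6%N) (th 0%N) - c (e 4%N) (th 2%N))
  + e 6%N u * (c (e 4%N) (th 1%N) - c (e 5%N) (th 0%N)).
Proof.
move=> e th c eu0.
pose m s i j := e (nth 0%N s i).-1 (if j is j'.+1 then y (inord j') else u).
have E s : coframe_form b s (fcons u y) = \det (\matrix_(i < 4, j < 4) m s i j).
  congr (\det _); apply/matrixP => i j; rewrite !mxE (tnth_nth 0%N).
  case: (unliftP ord0 j) => [j' ->|->]; last by rewrite fcons0.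
  by rewrite fconsS /m /= inord_val.
rewrite /dual_G2_form !E !det4E /minor2 /m /=.
rewrite !(eu0 0%N, eu0 1%N, eu0 2%N, eu0 3%N) //.
by rewrite /c /th /two_form /wedge12 /=; ring.
Qed.

(** Here [beta k] is -de^(5+k). By the first hypothesis e^1, .., e^4 are closed, so only e^5, e^6,
    e^7 get differentiated, and each component of the result is a difference of two products that
    the second hypothesis makes equal. *)
Lemma CE_d_dual (br : g -> g -> g) (b : 7.-tuple g) (x : 'I_5 -> g) :
  let e (k : nat) : g -> R := coord b (inord k) in
  let th k := two_form e (theta R k) in
  let beta k u v := e (4 + k)%N (br u v) in
  (forall k u v, (k < 4)%N -> e k (br u v) = 0) ->
  (forall i j y0 y1 y2 y3, (i < j < 3)%N ->
    wedge22 (beta i) (th j) y0 y1 y2 y3 =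
    wedge22 (beta j) (th i) y0 y1 y2 y3) ->
  CE_d br (dual_G2_form b) x = 0.
Proof.
move=> e th beta e0 W.
have dualE u v y :
    let c f h := wedge12 f h (y (inord 0)) (y (inord 1)) (y (inord 2)) in
    dual_G2_form b (fcons (br u v) y) =
      beta 0%N u v * (c (e 5%N) (th 2%N) - c (e 6%N) (th 1%N))
    + beta 1%N u v * (c (e 6%N) (th 0%N) - c (e 4%N) (th 2%N))
    + beta 2%N u v * (c (e 4%N) (th 1%N) - c (e 5%N) (th 0%N)).
  by apply: dual_G2_form_fcons => k; exact: e0.
(* What remains is a polynomial identity in the values of these functions, so their bodies can be
   forgotten before [ring]. *)
clearbody th beta e.
pose X n := x (inord n).
have xE i : x i = X (val i) by rewrite /X inord_val.
pose D i j p q r s : R := wedge22 (beta i) (th j) (X p) (X q) (X r) (X s)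
  - wedge22 (beta j) (th i) (X p) (X q) (X r) (X s).
(* The three terms are the components of d( *phi) along e^5, e^6 and e^7. *)
pose S m p q r s := e 4%N (X m) * D 1%N 2%N p q r s
  - e 5%N (X m) * D 0%N 2%N p q r s + e 6%N (X m) * D 0%N 1%N p q r s.
have S0 m p q r s : S m p q r s = 0.
  rewrite /S /D !(W 0%N 1%N, W 0%N 2%N, W 1%N 2%N) //.
  by rewrite !subrr !mulr0 subr0 addr0.
(* Shuffle expansion of a 1-form wedged with a 4-form: each of the five vectors in turn is fed to
   the 1-form. *)
transitivity ((S 0 1 2 3 4)%N - (S 1 0 2 3 4)%N + (S 2 0 1 3 4)%N
  - (S 3 0 1 2 4)%N + (S 4 0 1 2 3)%N).
  rewrite /CE_d /S /D.
  under eq_bigr => i _ do rewrite big_mkcond /=.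
  rewrite !(big_ord_recl, big_ord0) /=.
  rewrite !dualE /= !xE /= /bump /= !inordK //.
  rewrite ?add0n ?add1n.
  by rewrite /wedge12 /wedge22; ring.
by rewrite !S0 !subr0 !addr0.
Qed.
End CoclosedFrame.

Lemma exists_basis_tuple (K : fieldType) (V : vectType K) (U : {vspace V}) n :
  \dim U = n -> exists X : n.-tuple V, basis_of U X.
Proof. by move <-; exists (vbasis U); apply: vbasisP. Qed.

(** * Bilinear calculus of the bracket *)

Section LieBracket.
Variables (R : fieldType) (g : vectType R) (br : g -> g -> g).
Hypothesis br_lie : is_lie_bracket br.

Lemma lie_addl x y z : br (x + y) z = br x z + br y z.
Proof. by have := lie_linear_l br_lie z 1 x y; rewrite !scale1r. Qed.

Lemma lie_addr x y z : br x (y + z) = br x y + br x z.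
Proof. by have := lie_linear_r br_lie x 1 y z; rewrite !scale1r. Qed.

Lemma lie0 x : br 0 x = 0.
Proof. by apply: (addIr (br 0 x)); rewrite -lie_addl !add0r. Qed.

Lemma lie_0 x : br x 0 = 0.
Proof. by apply: (addIr (br x 0)); rewrite -lie_addr !add0r. Qed.

Lemma lie_scalel a x z : br (a *: x) z = a *: br x z.
Proof. by have := lie_linear_l br_lie z a x 0; rewrite lie0 !addr0. Qed.

Lemma lie_scaler a x z : br x (a *: z) = a *: br x z.
Proof. by have := lie_linear_r br_lie x a z 0; rewrite lie_0 !addr0. Qed.

Lemma lie_anti x y : br y x = - br x y.
Proof.
have := lie_alternating br_lie (x + y); rewrite lie_addl !lie_addr.
rewrite !(lie_alternating br_lie) addr0 add0r addrC => /eqP.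
by rewrite addr_eq0 => /eqP.
Qed.

Lemma lie_suml (I : finType) (P : pred I) (F : I -> g) y :
  br (\sum_(i | P i) F i) y = \sum_(i | P i) br (F i) y.
Proof. by apply: (big_morph (br^~ y)) => [u v|]; rewrite ?lie0 ?lie_addl. Qed.

Lemma lie_sumr (I : finType) (P : pred I) (F : I -> g) x :
  br x (\sum_(i | P i) F i) = \sum_(i | P i) br x (F i).
Proof. by apply: (big_morph (br x)) => [u v|]; rewrite ?lie_0 ?lie_addr. Qed.

(** The vectors of [b] from index 4 on are central, so the alternating form [f (br x y)] is
    determined by its values on pairs of the first four. *)
Lemma lie_two_form (b : 7.-tuple g) (f : {scalar g}) x y :
  basis_of fullv b ->
  (forall k z, (4 <= k)%N -> br b`_k z = 0) ->
  let c i j : R := f (br b`_i b`_j) in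
  f (br x y) = two_form (fun k : nat => coord b (inord k))
    (c 0%N 1%N, c 0%N 2%N, c 0%N 3%N, c 1%N 2%N, c 1%N 3%N, c 2%N 3%N) x y.
Proof.
move=> bB bC c.
have cC i j : (4 <= i)%N || (4 <= j)%N -> c i j = 0.
  move=> /orP[]h; first by rewrite /c bC // raddf0.
  by rewrite /c lie_anti bC // oppr0 raddf0.
have cD i : c i i = 0 by rewrite /c lie_alternating // raddf0.
have cN i j : c i j = - c j i by rewrite /c lie_anti raddfN.
pose X k : R := coord b (inord k) x.
pose Y k : R := coord b (inord k) y.
have -> : f (br x y) = \sum_(i < 7) \sum_(j < 7) X i * Y j * c i j.
  rewrite {1}(coord_basis bB (memvf x)) {1}(coord_basis bB (memvf y)).
  rewrite lie_suml linear_sum; apply: eq_bigr => i _.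
  rewrite lie_sumr linear_sum; apply: eq_bigr => j _.
  by rewrite lie_scalel lie_scaler scalerA linearZ /X /Y !inord_val.
rewrite !big_ord_recl !big_ord0 /= /bump /= ?add0n ?add1n.
rewrite !cD !(cC 4%N, cC 5%N, cC 6%N, cC _ 4%N, cC _ 5%N, cC _ 6%N) //.
rewrite (cN 1%N 0%N) (cN 2%N 0%N) (cN 3%N 0%N) (cN 2%N 1%N) (cN 3%N 1%N).
rewrite (cN 3%N 2%N) /two_form -!/(X _) -!/(Y _).
ring.
Qed.
End LieBracket.

(** * Coclosed structures from a central subspace containing all brackets *)

Lemma symmetrizable (R : fieldType) n (M : 'M[R]_n) :
  exists2 A, A \in unitmx & (A *m M)^T = A *m M.
Proof.
(* [col_ebase M], [pid_mx (\rank M)] and [row_ebase M] are the factors L, D, U of [M]. *)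
exists ((row_ebase M)^T *m invmx (col_ebase M)).
  by rewrite unitmx_mul unitmx_tr unitmx_inv row_ebase_unit col_ebase_unit.
have -> : (row_ebase M)^T *m invmx (col_ebase M) *m M =
    (row_ebase M)^T *m (pid_mx (\rank M) *m row_ebase M).
  rewrite -{3}(mulmx_ebase M) -mulmxA -!(mulmxA (col_ebase M)).
  by rewrite mulKmx ?col_ebase_unit.
by rewrite !trmx_mul trmxK tr_pid_mx mulmxA.
Qed.

Section Coclosed.
Variables (R : realType) (g : vectType R) (br : g -> g -> g).
Hypothesis br_lie : is_lie_bracket br.

Lemma coclosed_of_central_subspace (C : {vspace g}) :
  \dim {:g} = 7%N -> \dim C = 3%N ->
  (forall x y, br x y \in C) -> (forall x y, x \in C -> br x y = 0) ->
  exists phi : kform g 3, is_G2_structure phi /\ coclosed br phi.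
Proof.
move=> dimg dimC brC cC.
have [c cB] := exists_basis_tuple dimC.
have dimV : \dim C^C = 4%N by rewrite dimv_compl dimg dimC.
have [v vB] := exists_basis_tuple dimV.
pose q (u : g -> g -> R) : form2 R :=
  (u v`_0 v`_1, u v`_0 v`_2, u v`_0 v`_3, u v`_1 v`_2, u v`_1 v`_3,
   u v`_2 v`_3).
(* Up to sign, the coefficients of de^(5+k) /\ th_j for the initial basis [c]. The covectors e^1,
   .., e^4 depend on [v] and [C] only, so a later change of basis of [C] leaves the th_j fixed. *)
pose M : 'M[R]_3 := \matrix_(k, j)
  pairing (q (fun x y => coord c k (br x y))) (theta R j).
have [A Au As] := symmetrizable M.
(* Vectors are transformed by the inverse of [A] so that the dual covectors e^5, e^6, e^7 are
   transformed by [A]. *)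
pose f := [tuple \sum_k invmx A k i *: c`_k | i < 3].
pose b : 7.-tuple g := [tuple of v ++ f].
have cE (k : 'I_3) : c`_k = \sum_i A i k *: f`_i.
  transitivity (\sum_(l < 3) (invmx A *m A) l k *: c`_l).
    rewrite mulVmx // (bigD1 k) //= big1 => [|l /negPf lk]; last first.
      by rewrite mxE lk scale0r.
    by rewrite mxE eqxx scale1r addr0.
  under eq_bigr => l _ do rewrite mxE scaler_suml.
  rewrite exchange_big; apply: eq_bigr => i _.
  rewrite -tnth_nth tnth_mktuple scaler_sumr; apply: eq_bigr => l _.
  by rewrite scalerA mulrC.
have bB : basis_of fullv b.
  rewrite basisEdim size_tuple dimg leqnn andbT -(addv_complf C) addvC span_cat.
  apply: addvS; first by rewrite (span_basis vB).
  rewrite -(span_basis cB); apply/span_subvP => z /(nthP 0)[k].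
  rewrite size_tuple => k3 <-.
  rewrite (cE (Ordinal k3)); apply: memv_suml => i _; apply/memvZ/memv_span.
  by rewrite mem_nth ?size_tuple.
have bv (i : nat) : (i < 4)%N -> b`_i = v`_i.
  by move=> i4; rewrite nth_cat size_tuple i4.
have bf (i : nat) : b`_(4 + i) = f`_i.
  by rewrite nth_cat size_tuple ltnNge leq_addr addKn.
have bC (k : nat) z : (4 <= k)%N -> br b`_k z = 0.
  move=> k4; rewrite -(subnKC k4) bf cC //.
  (* For [k >= 7] the entry is the default value 0 of [nth]. *)
  have [k3|k3] := ltnP (k - 4) 3; last first.
    by rewrite nth_default ?size_tuple ?mem0v.
  rewrite -(tnth_nth 0 f (Ordinal k3)) tnth_mktuple.
  apply: memv_suml => i _; apply: memvZ.
  by rewrite -(span_basis cB) memv_span // mem_nth ?size_tuple.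
pose h x y i := \sum_k A i k * coord c k (br x y).
have brE x y : br x y = \sum_(i < 3) h x y i *: f`_i.
  rewrite {1}(coord_basis cB (brC x y)).
  under eq_bigr => k _ do rewrite cE scaler_sumr.
  rewrite exchange_big; apply: eq_bigr => i _; rewrite scaler_suml.
  by apply: eq_bigr => k _; rewrite scalerA mulrC.
pose h7 x y (j : 'I_7) :=
  match split (j : 'I_(4 + 3)) with inl _ => 0 | inr i => h x y i end.
have coordE x y (j : 'I_7) : coord b j (br x y) = h7 x y j.
  rewrite -[RHS](coord_sum_free (h7 x y) _ (basis_free bB)).
  congr (coord _ _ _); rewrite (@big_split_ord _ _ _ 4 3) /=.
  rewrite big1 => [|i _]; last by rewrite /h7 (unsplitK (inl _ i)) scale0r.
  rewrite add0r {1}brE; apply: eq_bigr => i _.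
  by rewrite /h7 (unsplitK (inr _ i)) bf.
have e_lo x y k : (k < 4)%N -> coord b (inord k) (br x y) = 0.
  move=> k4; rewrite coordE /h7; case: splitP => // i.
  by rewrite inordK ?(ltn_trans k4) // => ki; rewrite ki ltnNge leq_addr in k4.
have e_hi x y (i : 'I_3) :
    coord b (inord (4 + i)) (br x y) = h x y i.
  rewrite coordE /h7; case: splitP => [j|j].
    rewrite inordK ?(ltn_add2l 4 i 3) // => ji.
    by have := ltn_ord j; rewrite -ji ltnNge leq_addr.
  by rewrite inordK ?(ltn_add2l 4 i 3) // => /addnI/val_inj ->.
pose e (k : nat) : g -> R := coord b (inord k).
have betaE x y (i : 'I_3) :
    e (4 + i)%N (br x y) = two_form e (q (fun x y => e (4 + i)%N (br x y))) x y.
  have := lie_two_form br_lie (coord b (inord (4 + i))) x y bB bC.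
  by rewrite /= !bv.
(* The new covectors are [A]-combinations of the old ones and [pairing] is linear in its first
   argument, so the matrix is multiplied by [A] on the left. *)
have pairE (i j : 'I_3) :
    pairing (q (fun x y => e (4 + i)%N (br x y))) (theta R j) = (A *m M) i j.
  rewrite mxE; under eq_bigr => k _ do rewrite mxE.
  rewrite /q /e !e_hi /h !big_ord_recl !big_ord0.
  case: (theta R j) => [[[[[d01 d02] d03] d12] d13] d23].
  by rewrite /pairing; ring.
have G2b : G2_adapted (G2_form b) b by [].
exists (G2_form b); split; first by exists b.
exists b; split=> // x.
transitivity (CE_d br (dual_G2_form b) x).
  by apply: eq_bigr => i _; apply: eq_bigr => j _; rewrite hodge_G2_form.
apply: CE_d_dual => [k y z|i j y0 y1 y2 y3 /andP[ij j3]]; first exact: e_lo.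
have i3 := ltn_trans ij j3.
have W (k l : 'I_3) :
    wedge22 (fun x y => e (4 + k)%N (br x y)) (two_form e (theta R l))
      y0 y1 y2 y3 =
    (A *m M) k l * wedge22 (two_form e (1, 0, 0, 0, 0, 0))
      (two_form e (0, 0, 0, 0, 0, 1)) y0 y1 y2 y3.
  by rewrite -pairE -wedge22_two_form /wedge22 -!betaE.
rewrite (W (Ordinal i3) (Ordinal j3)) (W (Ordinal j3) (Ordinal i3)).
by congr (_ * _); rewrite -{1}As mxE.
Qed.
End Coclosed.

(** * Central subspaces and the dimension of the center *)

Lemma exists_intermediate_subspace (K : fieldType) (V : vectType K)
    (U W : {vspace V}) n :
  (U <= W)%VS -> (\dim U <= n <= \dim W)%N ->
  exists C : {vspace V}, [/\ (U <= C)%VS, (C <= W)%VS & \dim C = n].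
Proof.
(* [U] is enlarged by the first [n - \dim U] vectors of a basis of a complement of [U] in [W]. *)
move=> UW /andP[Un nW]; set X := vbasis (W :\: U); set Y := take (n - \dim U) X.
have dimX : \dim (W :\: U) = (\dim W - \dim U)%N.
  by rewrite -(dimv_cap_compl W U) (capv_idPr UW) addKn.
have XD : <<X>>%VS = (W :\: U)%VS := span_basis (vbasisP _).
have YX : (<<Y>> <= W :\: U)%VS by rewrite -XD; apply: sub_span => y /mem_take.
exists (U + <<Y>>)%VS; split; first exact: addvSl.
  by rewrite subv_add UW (subv_trans YX) ?diffvSl.
rewrite dimv_disjoint_sum; last first.
  by apply/eqP; rewrite -subv0 -(capv_diff W U) capvC capvS.
have /catl_free/eqP -> : free (Y ++ drop (n - \dim U) X).
  by rewrite cat_take_drop (basis_free (vbasisP _)).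
by rewrite size_takel ?subnKC // size_tuple dimX leq_sub2r.
Qed.

Section Center.
Variables (R : numFieldType) (g : vectType R) (br : g -> g -> g).
Hypothesis br_lie : is_lie_bracket br.

(** Named so that linearity in [x] can be registered as an instance, which [linfun] needs. *)
Definition bracket_left (y x : g) : g := br x y.

HB.instance Definition _ y :=
  GRing.isLinear.Build R g g _ (bracket_left y) (lie_linear_l br_lie y).

(** The center is the intersection of the kernels of the maps x |-> [x, b_i] over a basis of [g]. *)
Lemma exists_center :
  exists Z : {vspace g}, forall u, u \in Z <-> forall y, br u y = 0.
Proof.
pose b := vbasis (fullv : {vspace g}).
exists (\bigcap_(i < \dim {:g}) lker (linfun (bracket_left b`_i)))%VS => u.
split=> [|uC]; last first.
  rewrite memvE; apply/subv_bigcapP => i _.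
  by rewrite -memvE memv_ker lfunE /= /bracket_left uC.
rewrite memvE => /subv_bigcapP H y.
rewrite (coord_vbasis (memvf y)) lie_sumr // big1 // => i _.
have := H i isT; rewrite -memvE memv_ker lfunE /= /bracket_left => /eqP bu.
by rewrite lie_scaler // -/b bu scaler0.
Qed.

Variable Z : {vspace g}.
Hypothesis ZP : forall u, u \in Z <-> forall y, br u y = 0.
Hypothesis brZ : forall x y, br x y \in Z.

(** Since [U, g] lies in both [U] and [Z], a trivial intersection would make [U] central, hence
    contained in [Z] and zero. *)
Lemma ideal_meets_center (U : {vspace g}) :
  is_ideal br U -> U != 0%VS -> (U :&: Z != 0)%VS.
Proof.
move=> Uid; apply: contraNN => /eqP UZ0; rewrite -subv0 -UZ0 subv_cap subvv /=.
apply/subvP => u uU; apply/ZP => y; apply/eqP.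
rewrite -memv0 -UZ0 memv_cap brZ andbT (lie_anti br_lie) memvN; exact: Uid.
Qed.

(* If the intersection with the center were a line N, the bracket would be a
   nondegenerate alternating form on U / N, which has odd dimension. *)
Lemma dim_center_of_even_ideal (U W : {vspace g}) :
  is_ideal br U -> is_ideal br W -> (U + W)%VS = fullv -> (U :&: W)%VS = 0%VS ->
  U != 0%VS -> ~~ odd (\dim U) -> (2 <= \dim (U :&: Z))%N.
Proof.
move=> Uid Wid UWf UW0 U0 Uev; set N := (U :&: Z)%VS.
have NZ : (N <= Z)%VS := capvSr _ _.
have := ideal_meets_center Uid U0; rewrite -/N -dimv_eq0 => dN0.
rewrite ltn_neqAle lt0n dN0 andbT; apply/eqP => dN1.
pose T := (U :\: Z)%VS.
have dT : (\dim U = (\dim T).+1)%N.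
  by rewrite -(dimv_cap_compl U Z) -/N -dN1 add1n.
pose X := vbasis T; have XB : basis_of T X := vbasisP T.
have TU : (T <= U)%VS := diffvSl _ _.
have XU i : X`_i \in U.
  have [iX|iX] := ltnP i (size X); last by rewrite nth_default ?mem0v.
  by rewrite (subvP TU) // (basis_mem XB) ?mem_nth.
have [z zB] : exists z : 1.-tuple g, basis_of N z.
  exact: exists_basis_tuple.
have brN x y : x \in U -> br x y = coord z ord0 (br x y) *: z`_0.
  move=> xU; have : br x y \in N.
    by rewrite memv_cap brZ andbT (lie_anti br_lie) memvN; apply: Uid.
  by move/(coord_basis zB); rewrite big_ord1.
pose A := \matrix_(i, j) coord z ord0 (br X`_i X`_j) : 'M_(\dim T).
(* Transposition negates [A], whose size [\dim T = \dim U - 1] is odd, so its determinant equals its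
   own opposite. *)
have detA : \det A == 0.
  have : \det A^T = \det (- A).
    by congr (\det _); apply/matrixP => i j; rewrite !mxE (lie_anti br_lie)
      linearN.
  rewrite det_tr -scaleN1r detZ -signr_odd.
  have -> : odd (\dim T) by move: Uev; rewrite dT /= negbK.
  by rewrite expr1 mulN1r => /eqP; rewrite -addr_eq0 -mulr2n mulrn_eq0.
have /det0P[r r0 rA] := detA.
pose x := \sum_i r 0 i *: X`_i.
have xT : x \in T.
  by apply: memv_suml => i _; rewrite memvZ // (basis_mem XB) ?mem_nth ?size_tuple.
have xU := subvP TU _ xT.
(* [x] is central: it commutes with [T] by the choice of [r], with [N] because [N] is central, and
   with [W] because [U, W] lies in both ideals. But [T] meets [Z] trivially. *)
have x0 : x = 0.
  apply/eqP; rewrite -memv0 -(capv_diff U Z) memv_cap xT /=; apply/ZP => y.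
  have : y \in (T + N + W)%VS by rewrite addv_diff_cap UWf memvf.
  case/memv_addP => _ /memv_addP[t tT [n nN ->]] [w wW ->].
  rewrite !(lie_addr br_lie).
  have -> : br x n = 0.
    by rewrite (lie_anti br_lie) ((ZP _).1 (subvP NZ _ nN)) oppr0.
  have -> : br x w = 0.
    apply/eqP; rewrite -memv0 -UW0 memv_cap Wid // andbT.
    by rewrite (lie_anti br_lie) memvN Uid.
  rewrite !addr0 (coord_basis XB tT) lie_sumr // big1 // => j _.
  rewrite lie_scaler // lie_suml //.
  under eq_bigr => i _ do rewrite lie_scalel // brN // scalerA.
  rewrite -scaler_suml; have /matrixP/(_ 0 j) := rA; rewrite !mxE.
  by under eq_bigr => i _ do rewrite mxE; move=> ->; rewrite scale0r scaler0.
case/eqP: r0; apply/rowP => i; rewrite mxE.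
by rewrite -(coord_sum_free (fun i => r 0 i) i (basis_free XB)) -/x x0 linear0.
Qed.

Lemma dim_center_ge3 : decomposable br -> odd (\dim {:g}) -> (3 <= \dim Z)%N.
Proof.
case=> U [W [Uid Wid U0 W0 [UWf UW0]]].
rewrite -UWf dimv_disjoint_sum // oddD => UWodd.
have dimZ : (\dim (U :&: Z) + \dim (W :&: Z) <= \dim Z)%N.
  rewrite -dimv_disjoint_sum; first by rewrite dimvS // subv_add !capvSr.
  by apply/eqP; rewrite -subv0 -UW0 capvS ?capvSl.
apply: leq_trans dimZ.
have := ideal_meets_center Uid U0; have := ideal_meets_center Wid W0.
rewrite -!dimv_eq0 -!lt0n => W1 U1.
have [Uodd|Uev] := boolP (odd (\dim U)).
  rewrite addnC (@leq_add 2 1) //.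
  apply: dim_center_of_even_ideal Wid Uid _ _ W0 _;
    rewrite ?(addvC W) ?(capvC W) //.
  by move: UWodd; rewrite Uodd.
by rewrite (@leq_add 2 1) // (dim_center_of_even_ideal Uid Wid).
Qed.

Lemma exists_central_subspace : \dim {:g} = 7%N -> (3 <= \dim Z)%N ->
  exists C : {vspace g},
    [/\ \dim C = 3%N, (C <= Z)%VS & forall x y, br x y \in C].
Proof.
move=> dimg; rewrite leq_eqVlt => /orP[/eqP Z3|Z4]; first by exists Z.
(* A complement of [Z] has dimension at most 3; it is padded to exactly 3, so that [T + Z] is
   everything and [T] has three basis vectors to name. *)
have [|T [ZT _ dT]] :=
  @exists_intermediate_subspace _ _ Z^C%VS fullv 3 (subvf _).
  by rewrite dimv_compl dimg leq_subLR (@leq_add 4 3).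
have [X XB] : exists X : 3.-tuple g, basis_of T X.
  exact: exists_basis_tuple.
(* Modulo the center every vector is a combination of the three basis vectors of [T], so these three
   brackets span all brackets. *)
pose D := <<[:: br X`_0 X`_1; br X`_0 X`_2; br X`_1 X`_2]>>%VS.
have DZ : (D <= Z)%VS by apply/span_subvP => u; rewrite !inE => /or3P[]/eqP ->.
have [|C [DC CZ dC]] := exists_intermediate_subspace DZ (n := 3).
  by rewrite (dim_span [:: _; _; _]) ltnW.
exists C; split=> // x y; apply: (subvP DC).
have dec u : exists (a : 'I_3 -> R) z, z \in Z /\ u = \sum_i a i *: X`_i + z.
  have : u \in (T + Z)%VS.
    by rewrite (subvP _ _ (memvf u)) // -(addv_complf Z) addvC addvS.
  case/memv_addP => t tT [z zZ ->]; exists (fun i => coord X i t), z.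
  by split=> //; rewrite -(coord_basis XB tT).
have [a [z [zZ ->]]] := dec x; have [c [w [wZ ->]]] := dec y.
rewrite (lie_addl br_lie) ((ZP _).1 zZ) addr0 (lie_addr br_lie).
rewrite [X in _ + X](lie_anti br_lie) ((ZP _).1 wZ) oppr0 addr0.
rewrite lie_suml //; apply: memv_suml => i _.
rewrite lie_sumr //; apply: memv_suml => j _.
rewrite lie_scalel // lie_scaler // !memvZ //.
have D01 : br X`_0 X`_1 \in D by rewrite memv_span // !inE eqxx.
have D02 : br X`_0 X`_2 \in D by rewrite memv_span // !inE eqxx orbT.
have D12 : br X`_1 X`_2 \in D by rewrite memv_span // !inE eqxx !orbT.
case: i j => [[|[|[|//]]] ?] [[|[|[|//]]] ?] //=;
  by rewrite ?(lie_alternating br_lie) ?mem0v // (lie_anti br_lie) memvN.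
Qed.
End Center.

Theorem corollary15 (R : realType) (g : vectType R) (br : g -> g -> g)
  (br_lie : is_lie_bracket br) (dim_g : \dim {:g} = 7%N)
  (g_dec : decomposable br) (g_2step : two_step_nilpotent br) :
  exists phi : kform g 3, is_G2_structure phi /\ coclosed br phi.
Proof.
have [Z ZP] := exists_center br_lie.
have brZ x y : br x y \in Z.
  by apply/ZP => z; rewrite (lie_anti br_lie) g_2step.2 oppr0.
have Z3 : (3 <= \dim Z)%N.
  by apply: (dim_center_ge3 br_lie ZP brZ g_dec); rewrite dim_g.
have [C [C3 CZ brC]] := exists_central_subspace br_lie ZP brZ dim_g Z3.
apply: (coclosed_of_central_subspace br_lie dim_g C3 brC) => x y xC.
exact: (ZP x).1 (subvP CZ _ xC) y.
Qed.
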